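(* The following assertions hold true: (i) $\overline{\mathcal{H}}=\mathcal{N}$; (ii) if $P$ and $Q$ are closed, then $\overline{\mathcal{K}}=\mathcal{M}$.
   Context: Setting: $(X,Y)$ and $(Z,W)$ are separated dual pairs of real vector spaces, i.e. there are bilinear forms on $X\times Y$ and on $Z\times W$, both denoted $\langle\cdot,\cdot\rangle$, such that $\langle x_0,y\rangle=0$ for all $y\in Y$ implies $x_0=0$, and $\langle x,y_0\rangle=0$ for all $x\in X$ implies $y_0=0$ (and likewise for $(Z,W)$). For a separated dual pair $(E,F)$, $\sigma(E,F)$ denotes the weak topology on $E$: the coarsest topology making all functionals $\langle\cdot,f\rangle$, $f\in F$, continuous. All topological notions refer to the appropriate weak topologies: $\sigma(X,Y)$ on $X$, $\sigma(Z,W)$ on $Z$, and, for closures, $\sigma(Z\times\mathbb{R},W\times\mathbb{R})$ on $Z\times\mathbb{R}$ and $\sigma(Y\times\mathbb{R},X\times\mathbb{R})$ on $Y\times\mathbb{R}$, with pairings such as $\langle(z,r),(w,\beta)\rangle=\langle z,w\rangle+r\beta$. $A:X\to Z$ is a linear map that is $\sigma(X,Y)$-$\sigma(Z,W)$ continuous, and $A^*:W\to Y$ is its adjoint, the linear map with $\langle x,A^*w\rangle=\langle Ax,w\rangle$ for all $x\in X$, $w\in W$. $P\subset X$ and $Q\subset Z$ are convex cones (nonempty, and $\alpha u+\beta v$ is in the cone for all $\alpha,\beta\ge0$ and $u,v$ in the cone); $b\in Z$, $c\in Y$. Dual cones: $P^*=\{y\in Y:\langle x,y\rangle\ge0\ \forall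 x\in P\}$, $Q^*=\{w\in W:\langle q,w\rangle\ge0\ \forall q\in Q\}$. Feasible sets: $F(\mathcal{P})=\{x\in P:Ax-b\in Q\}$ and $F(\mathcal{D})=\{w\in Q^*:-A^*w+c\in P^*\}$; both are assumed nonempty. Definitions: $\mathcal{H}=\bigcup_{x\in P}\big((Ax-b-Q)\times[\langle x,c\rangle,+\infty[\big)\subset Z\times\mathbb{R}$; $\mathcal{K}=\bigcup_{w\in Q^*}\big((-A^*w+c-P^* )\times\,]-\infty,\langle b,w\rangle]\big)\subset Y\times\mathbb{R}$; $v_{\mathcal{D}}(z)=\sup\{\langle b+z,w\rangle:w\in F(\mathcal{D})\}$ for $z\in Z$; $v_{\mathcal{P}}(y)=\inf\{\langle x,c-y\rangle:x\in F(\mathcal{P})\}$ for $y\in Y$; $\mathcal{N}=\mathrm{epi}\,v_{\mathcal{D}}=\{(z,r)\in Z\times\mathbb{R}:v_{\mathcal{D}}(z)\le r\}$; $\mathcal{M}=\mathrm{hypo}\,v_{\mathcal{P}}=\{(y,r)\in Y\times\mathbb{R}:r\le v_{\mathcal{P}}(y)\}$. An overline denotes closure. *)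

(* Defs.v *)
From HB Require Import structures.
From mathcomp Require Import all_boot all_order all_algebra sesquilinear.
From mathcomp Require Import boolp classical_sets set_interval reals ereal.
From mathcomp Require Import topology normedtype.

Set Implicit Arguments.
Unset Strict Implicit.
Unset Printing Implicit Defensive.

Import Order.TTheory GRing.Theory Num.Theory.
Import numFieldNormedType.Exports.

Local Open Scope classical_set_scope.
Local Open Scope ring_scope.

Section dual_pairs.
Context {R : realType}.

Definition separated_pair {E F : lmodType R} (p : E -> F -> R) : Prop :=
  (forall x0, (forall y, p x0 y = 0) -> x0 = 0) /\
  (forall y0, (forall x, p x y0 = 0) -> y0 = 0).

(* [sigma p] is the type [E] equipped with the weak topology sigma(E, F) of
   the pairing [p]; sigma(F, E) is [sigma (fun y x => p x y)]. *)
Definition sigma {E : Type} {F : Type} (p : E -> F -> R) : Type := E.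

Definition sigma_def (E : choiceType) (F : Type) (p : E -> F -> R) :=
  sup_topology (fun f : F =>
    Topological.class (initial_topology (fun e : E => p e f))).

HB.instance Definition _ (E : choiceType) (F : Type) (p : E -> F -> R) :=
  Topological.copy (sigma p) (sigma_def p).

Lemma continuous_sigmaP (T : topologicalType) (E : choiceType) (F : Type)
    (p : E -> F -> R) (g : T -> sigma p) :
  continuous g <-> forall f : F, continuous (fun t => p (g t) f).
Proof.
split=> [cg f t|cg t].
  have := cg t; rewrite /continuous_at => /cvg_sup /(_ f) cgf.
  apply: (@cvg_comp _ _ _ g (p ^~ f) _ _ _ cgf).
  exact: (@initial_continuous _ _ (p ^~ f)).
apply/cvg_sup => f.
have := @continuous_comp_initial E T R (p ^~ f) g (cg f); exact.
Qed.

Definition pairingR {E F : Type} (p : E -> F -> R) (u : E * R) (v : F * R) : R :=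
  p u.1 v.1 + u.2 * v.2.

Definition convex_cone {E : lmodType R} (C : set E) : Prop :=
  C !=set0 /\
  forall (s t : R) (u v : E), 0 <= s -> 0 <= t -> C u -> C v ->
    C (s *: u + t *: v).

Definition dual_cone {E F : Type} (p : E -> F -> R) (C : set E) : set F :=
  [set y | forall x, C x -> 0 <= p x y].

End dual_pairs.

Section conic_programs.
Context {R : realType} {X Y Z W : lmodType R}.
(* [As] stands for the adjoint of [A]. *)
Implicit Types (pXY : X -> Y -> R) (pZW : Z -> W -> R).
Implicit Types (A : X -> Z) (As : W -> Y) (b : Z) (c : Y).
Implicit Types (P : set X) (Q : set Z).

Definition primal_feasible A b P Q : set X := [set x | P x /\ Q (A x - b)].

Definition dual_feasible pXY pZW As c P Q : set W :=
  [set w | dual_cone pZW Q w /\ dual_cone pXY P (- As w + c)].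

Definition setH pXY A b c P Q : set (Z * R) :=
  \bigcup_(x in P) ([set A x - b - q | q in Q] `*` `[pXY x c, +oo[).

Definition setK pXY pZW As b c P Q : set (Y * R) :=
  \bigcup_(w in dual_cone pZW Q)
    ([set - As w + c - y | y in dual_cone pXY P] `*` `]-oo, pZW b w]).

Definition value_dual pXY pZW As b c P Q (z : Z) : \bar R :=
  ereal_sup [set (pZW (b + z) w)%:E | w in dual_feasible pXY pZW As c P Q].

Definition value_primal pXY A b c P Q (y : Y) : \bar R :=
  ereal_inf [set (pXY x (c - y))%:E | x in primal_feasible A b P Q].

Definition epigraph (T : Type) (v : T -> \bar R) : set (T * R) :=
  [set tr | (v tr.1 <= tr.2%:E)%E].

Definition hypograph (T : Type) (v : T -> \bar R) : set (T * R) :=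
  [set tr | (tr.2%:E <= v tr.1)%E].

End conic_programs.

(* Main.v *)
Require Import Defs.
From mathcomp Require Import all_boot all_order all_algebra sesquilinear.
From mathcomp Require Import boolp classical_sets set_interval reals ereal.
From mathcomp Require Import topology normedtype.
From mathcomp Require Import derive ring lra.
From HB Require Import structures.

(** The closure of a convex set in a weak topology is the intersection of the
    closed half-spaces that contain it ([closure_sigma_convexP]).  A weak
    neighbourhood only constrains finitely many functionals, so this Hahn-Banach
    statement reduces to strict separation of a convex set of R^n from the
    origin, which is given by the point of its closure nearest to the origin
    ([strict_separation_rV]).

    Assertion (i) is then algebra.  Take a functional (w, beta) that is bounded
    above by s on H.  Since H contains rays in the directions (0, 1) and
    (-q, 0), and is stable under dilation of the point x of P, scaling gives
    beta <= 0, w in Q^*, and -beta c - A^* w in P^*; the point x = 0 gives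
    - <b, w> <= s ([bounded_functional_setH]).  If beta < 0, then w / (-beta)
    is dual feasible and the half-space is one of those that define the
    epigraph.  If beta = 0, then w is a recession direction of the dual feasible
    set; dual feasibility provides a point w0 to which t w can be added, and
    finiteness of the bound r >= <b + z, w0 + t w> for all t >= 0 forces
    <b + z, w> <= 0.  So every half-space containing H contains the epigraph
    ([closure_setH]).

    Assertion (ii) is (i) for the dual program, read as a primal one: the
    program with the pairs (W, Z) and (Y, X), the map - A^*, the cones Q^* and
    P^*, and the data - c and - b.  Its set H is the image of K under
    (y, r) |-> (y, - r), a weak homeomorphism.  When P and Q are closed, the
    bipolar theorem turns the dual of this program back into the original primal
    ([dual_feasible_dual]), so its epigraph is the reflected hypograph. *)

Set Implicit Arguments.
Unset Strict Implicit.
Unset Printing Implicit Defensive.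

Import Order.TTheory GRing.Theory Num.Theory.
Import numFieldNormedType.Exports.

Local Open Scope classical_set_scope.
Local Open Scope ring_scope.

(** * Separation in finite dimension *)

Definition convex_subset {R : realType} {E : lmodType R} (C : set E) : Prop :=
  forall (t : R) (u v : E), 0 <= t <= 1 -> C u -> C v ->
    C ((1 - t) *: u + t *: v).

Definition dotr {R : realType} {n : nat} (u v : 'rV[R]_n) : R :=
  \sum_i u 0 i * v 0 i.

Lemma dotr_comb_sqr (R : realType) n (t : R) (a d : 'rV[R]_n) :
  dotr ((1 - t) *: a + t *: d) ((1 - t) *: a + t *: d) =
  dotr a a + 2 * t * (dotr a d - dotr a a) +
  t ^+ 2 * dotr (d - a) (d - a).
Proof.
rewrite /dotr -sumrB !mulr_sumr -!big_split /=; apply: eq_bigr => i _.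
by rewrite !mxE; ring.
Qed.

Lemma continuous_dotr_sqr (R : realType) n :
  continuous (fun v : 'rV[R]_n => dotr v v).
Proof.
apply: continuous_big => [|i _ v]; first exact: add_continuous.
by apply: cvgM; [exact: (nbhs_filter v)|exact: coord_continuous..].
Qed.

Lemma continuous_homothety (R : realType) n (s : R) (w : 'rV[R]_n) :
  continuous (fun v : 'rV[R]_n => s *: v + w).
Proof.
move=> v; apply: cvgD.
  exact: (nbhs_filter v).
  exact: scaler_continuous.
exact: (@cst_continuous 'rV[R]_n 'rV[R]_n w v).
Qed.

(** The first-order condition at the left end of a segment: near t = 0 the
    linear term decides the sign of a quadratic. *)
Lemma nonneg_coef_small (R : realType) (m q : R) :
  (forall t, 0 <= t <= 1 -> 0 <= t * m + t ^+ 2 * q) -> 0 <= m.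
Proof.
move=> tmq; rewrite leNgt; apply/negP => m0.
(* This t makes t |q| = (t - 1) m, so that m + t q <= t m < 0. *)
pose t := - m / (`|q| - m).
have qm0 : 0 < `|q| - m by have := normr_ge0 q; lra.
have tE : t * (`|q| - m) = - m by rewrite /t divfK ?gt_eqF.
have t0 : 0 < t by rewrite divr_gt0 // oppr_gt0.
have t1 : t <= 1 by rewrite ler_pdivrMr // mul1r; have := normr_ge0 q; lra.
have /tmq : 0 <= t <= 1 by rewrite ltW.
have qle := ler_norm q.
have -> : t * m + t ^+ 2 * q = t * (m + t * q) by ring.
rewrite pmulr_rge0 //.
have : t * q <= t * `|q| by rewrite ler_wpM2l // ltW.
have tm : t * m < 0 by rewrite pmulr_rlt0.
have : t * `|q| = t * m - m by rewrite -tE; ring.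
by lra.
Qed.

(** The separating vector is the point [a] of the closure of [D] of least norm:
    moving from [a] towards a point [d] of [D] stays in the closure, so the norm
    does not decrease, which means <a, d> >= <a, a>. *)
Lemma strict_separation_rV (R : realType) n (D : set 'rV[R]_n) (eps : R) :
  convex_subset D -> (forall d, D d -> eps <= dotr d d) ->
  exists a, forall d, D d -> eps <= dotr a d.
Proof.
move=> cD Deps.
have [[d0 Dd0]|D0] := pselect (D !=set0); last first.
  by exists 0 => d Dd; exfalso; apply: D0; exists d.
pose f (v : 'rV[R]_n) := dotr v v.
have cf : continuous f := @continuous_dotr_sqr R n.
(* Cutting the closure by the ball through [d0] makes it compact without
   changing its point of least norm. *)
pose K := closure D `&` [set v | f v <= f d0].
have Kd0 : K d0 by split; [exact: subset_closure|rewrite /=].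
have sqr_box (v : 'rV[R]_n) i : f v <= f d0 -> `|v 0 i| <= f d0 + 1.
  move=> vd0; have vi : v 0 i ^+ 2 <= f v.
    rewrite /f /dotr (bigD1 i) //= -expr2 lerDl.
    by apply: sumr_ge0 => j _; rewrite -expr2 sqr_ge0.
  have /= : `|v 0 i| ^+ 2 <= f d0 by rewrite real_normK ?num_real//; lra.
  have := normr_ge0 (v 0 i); nra.
have compK : compact K.
  apply: (@subclosed_compact _ _ [set v : 'rV[R]_n |
      forall i, `[- (f d0 + 1), f d0 + 1]%classic (v ord0 i)]).
  - apply: closedI; first exact: closed_closure.
    by apply: (@preimage_closed _ _ f [set x | x <= f d0]) => [v _|];
      [exact: cf|exact: closed_le].
  - by apply: (@rV_compact _ _ (fun=> `[- (f d0 + 1), f d0 + 1]%classic)) => i;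
      exact: segment_compact.
  - move=> v [_ /= vd0] i /=; rewrite in_itv /= -ler_norml.
    exact: sqr_box.
have [a /set_mem[Da ad0] amin] : exists2 a, a \in K &
    forall v, v \in K -> f a <= f v.
  apply: compact_EVT_min => //; first by exists d0.
  exact: continuous_subspaceT.
have {}amin v : closure D v -> f a <= f v.
  move=> Dv; have [vd0|/ltW d0v] := leP (f v) (f d0).
    by apply: amin; exact/mem_set.
  exact: le_trans ad0 d0v.
have aeps : eps <= f a.
  have feps : closed [set v | eps <= f v].
    by apply: (@preimage_closed _ _ f [set x | eps <= x]) => [v _|];
      [exact: cf|exact: closed_ge].
  exact: (feps _ (closure_subset Deps Da)).
exists a => d Dd; apply: le_trans aeps _; rewrite -subr_ge0.
suff : 0 <= 2 * (dotr a d - dotr a a) by rewrite /f; lra.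
apply: (@nonneg_coef_small _ _ (dotr (d - a) (d - a))) => t t01.
(* The map v |-> (1 - t) v + t d sends [D] to itself, hence its closure to
   itself by continuity. *)
have Dt : closure D ((1 - t) *: a + t *: d).
  pose g (v : 'rV[R]_n) := (1 - t) *: v + t *: d.
  have cg : continuous g := @continuous_homothety R n (1 - t) (t *: d).
  have gD : D `<=` g @^-1` closure D.
    by move=> v Dv; apply: subset_closure; exact: cD.
  have gcl : closed (g @^-1` closure D).
    by apply: (@preimage_closed _ _ g (closure D)) => [v _|];
      [exact: cg|exact: closed_closure].
  exact: (gcl _ (closure_subset gD Da)).
have := amin _ Dt; rewrite /f dotr_comb_sqr; lra.
Qed.

(** * Closure in a weak topology *)

Lemma cvg_sigma (R : realType) (E : choiceType) (F : Type) (p : E -> F -> R)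
    (G : set_system E) (e : E) : Filter G ->
  (forall f, p x f @[x --> G] --> p e f) -> G --> (e : sigma p).
Proof.
move=> FG pG; apply/cvg_sup => f A.
move=> [_ [[B oB <-] Be BA]].
by apply: (filterS BA); apply: (pG f); apply: open_nbhs_nbhs; split.
Qed.

Lemma closure_sigma_halfspace (R : realType) (E : choiceType) (F : Type)
    (p : E -> F -> R) (C : set E) (e : E) (f : F) (s : R) :
  closure (C : set (sigma p)) e -> (forall x, C x -> p x f <= s) -> p e f <= s.
Proof.
move=> Ce Cs.
have cf : continuous (fun x : sigma p => p x f).
  by apply: (continuous_sigmaP (fun x : sigma p => (x : sigma p))).1 => x;
    exact: cvg_id.
have clf : closed [set x : sigma p | p x f <= s].
  apply: (@preimage_closed (sigma p) R (fun x : sigma p => p x f)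
    [set r | r <= s]).
    by move=> v _; exact: cf.
  exact: closed_le.
exact: (clf _ (@closure_subset (sigma p) C _ Cs _ Ce)).
Qed.

(** The sets of points of [C] that are [eps]-close to [e] for finitely many
    functionals generate a proper filter that converges weakly to [e]. *)
Lemma closure_sigma_approx (R : realType) (E F : choiceType)
    (p : E -> F -> R) (C : set E) (e : E) :
  (forall (n : nat) (f : 'I_n -> F) (eps : R), 0 < eps ->
    exists2 x, C x & forall i, `|p e (f i) - p x (f i)| < eps) ->
  closure (C : set (sigma p)) e.
Proof.
move=> Capprox.
pose B (k : seq F * R) : set E :=
  [set x | C x /\ forall f, f \in k.1 -> `|p e f - p x f| < k.2].
pose G : set_system E := filter_from [set k | 0 < k.2] B.
have FG : Filter G.
  apply: filter_from_filter => [|[k1 d1] [k2 d2] /= d10 d20].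
    by exists ([::], 1) => /=.
  exists (k1 ++ k2, Num.min d1 d2); first by rewrite /= lt_min d10.
  move=> x [Cx xk]; split; split=> // f fk /=.
    have := xk f; rewrite /= lt_min mem_cat.
    by move=> /(_ (introT orP (or_introl fk))) /andP[].
  have := xk f; rewrite /= lt_min mem_cat.
  by move=> /(_ (introT orP (or_intror fk))) /andP[].
have PG : ProperFilter G.
  apply: filter_from_proper => -[k eps] /= eps0.
  have [x Cx xk] := Capprox (size k) (fun i => tnth (in_tuple k) i) _ eps0.
  by exists x; split=> // f /(@tnthP _ _ (in_tuple k))[i ->].
have Ge : G --> (e : sigma p).
  apply: cvg_sigma => f; apply/cvgrPdist_lt => eps eps0.
  by exists ([:: f], eps) => //= x [_]; apply; rewrite inE.
move=> A /Ge GA; have GC : G C by exists ([::], 1) => //= x [].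
exact: (@filter_ex _ G _ _ (filterI GC GA)).
Qed.

(** Geometric Hahn-Banach for a weak topology.  If [e] is not in the closure,
    finitely many functionals [f i] keep [C] at a distance from [e].  Their
    deviations from the values at [e] map [C] to a convex subset of R^n away from
    the origin, and the coefficients of a vector that separates this subset
    combine the [f i] into one functional. *)
Lemma closure_sigma_convexP (R : realType) (E F : lmodType R)
    (p : {bilinear E -> F -> R | *%R & *%R}) (C : set E) (e : E) :
  convex_subset C ->
  closure (C : set (sigma p)) e <->
  (forall f s, (forall x, C x -> p x f <= s) -> p e f <= s).
Proof.
move=> cC; split=> [Ce f s|halfspaces]; first exact: closure_sigma_halfspace.
apply: closure_sigma_approx => n f eps eps0; apply: contrapT => far.
pose dev x : 'rV[R]_n := \row_i (p x (f i) - p e (f i)).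
have cD : convex_subset (dev @` C).
  move=> t _ _ t01 [x Cx <-] [y Cy <-].
  exists ((1 - t) *: x + t *: y); first exact: cC.
  by apply/rowP => i; rewrite !mxE linearDl !linearZl_LR; ring.
have farD d : (dev @` C) d -> eps ^+ 2 <= dotr d d.
  move=> [x Cx <-]; have [i] : exists i, eps <= `|p e (f i) - p x (f i)|.
    apply: contrapT => near; apply: far; exists x => // i.
    by rewrite ltNge; apply/negP => xi; apply: near; exists i.
  rewrite distrC => epsi; rewrite /dotr (bigD1 i) //= -expr2 mxE.
  rewrite -[leLHS]addr0 lerD //.
    by rewrite -[leRHS]real_normK ?num_real// lerXn2r // nnegrE ?normr_ge0 ?ltW.
  by apply: sumr_ge0 => j _; rewrite -expr2 sqr_ge0.
have [a asep] := strict_separation_rV cD farD.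
pose g := - \sum_i a 0 i *: f i.
have pg x : p x g = - \sum_i a 0 i * p x (f i).
  rewrite linearNr linear_sumr; congr (- _).
  by apply: eq_bigr => i _; rewrite linearZr_LR.
have : p e g <= p e g - eps ^+ 2.
  apply: halfspaces => x Cx; have := asep _ (imageP dev Cx).
  have -> : dotr a (dev x) = p e g - p x g.
    rewrite !pg opprK addrC -sumrB; apply: eq_bigr => i _.
    by rewrite mxE mulrBr.
  by lra.
by have := exprn_gt0 2 eps0; lra.
Qed.

(** * Bilinear structure on the derived pairings *)

Lemma pairingR_is_bilinear (R : realType) (E F : lmodType R)
    (p : {bilinear E -> F -> R | *%R & *%R}) :
  bilinear_for *%R *%R (pairingR p).
Proof.
split=> u a x y /=; rewrite /pairingR /= -[a *: _ : R]/(a * _).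
  by rewrite linearDl linearZl_LR; ring.
by rewrite linearDr linearZr_LR; ring.
Qed.

HB.instance Definition _ (R : realType) (E F : lmodType R)
    (p : {bilinear E -> F -> R | *%R & *%R}) :=
  bilinear_isBilinear.Build R (E * R)%type (F * R)%type R *%R *%R (pairingR p)
    (pairingR_is_bilinear p).

Definition flip_pairing {E F T : Type} (p : E -> F -> T) : F -> E -> T :=
  fun y x => p x y.

Lemma flip_pairing_is_bilinear (R : realType) (E F : lmodType R)
    (p : {bilinear E -> F -> R | *%R & *%R}) :
  bilinear_for *%R *%R (flip_pairing p).
Proof. by split=> u a x y /=; rewrite /flip_pairing /= ?linearPr ?linearPl. Qed.

HB.instance Definition _ (R : realType) (E F : lmodType R)
    (p : {bilinear E -> F -> R | *%R & *%R}) :=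
  bilinear_isBilinear.Build R F E R *%R *%R (flip_pairing p)
    (flip_pairing_is_bilinear p).

(** * Convex cones and the bipolar theorem *)

Lemma nonpos_of_scaled_bound (R : realType) (m s : R) :
  (forall t, 0 <= t -> t * m <= s) -> m <= 0.
Proof.
move=> tms; rewrite leNgt; apply/negP => m0.
have s0 : 0 <= s by have := tms 0 (lexx 0); rewrite mul0r.
have := tms ((s + 1) / m) (divr_ge0 (addr_ge0 s0 ler01) (ltW m0)).
by rewrite divfK ?gt_eqF //; lra.
Qed.

Lemma convex_cone0 (R : realType) (E : lmodType R) (C : set E) :
  convex_cone C -> C 0.
Proof.
by move=> [[u Cu] CC]; have := CC 0 0 u u (lexx _) (lexx _) Cu Cu;
   rewrite scale0r addr0.
Qed.

Lemma convex_coneZ (R : realType) (E : lmodType R) (C : set E) (t : R) (u : E) :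
  convex_cone C -> 0 <= t -> C u -> C (t *: u).
Proof.
move=> [_ CC] t0 Cu; have := CC t 0 u u t0 (lexx _) Cu Cu.
by rewrite scale0r addr0.
Qed.

Lemma convex_cone_convex (R : realType) (E : lmodType R) (C : set E) :
  convex_cone C -> convex_subset C.
Proof.
by move=> [_ CC] t u v /andP[t0 t1] Cu Cv; apply: CC => //; rewrite subr_ge0.
Qed.

Lemma convex_cone_dual (R : realType) (E F : lmodType R)
    (p : {bilinear E -> F -> R | *%R & *%R}) (C : set E) :
  convex_cone (dual_cone p C).
Proof.
split; first by exists 0 => x _; rewrite linear0r.
move=> s t u v s0 t0 Cu Cv x Cx; rewrite linearDr !linearZr_LR.
by rewrite addr_ge0 // mulr_ge0 //; [exact: Cu|exact: Cv].
Qed.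

(** A functional bounded above on a cone is nonpositive on it, so the
    half-spaces of [closure_sigma_convexP] can be taken through the origin, where
    they are those that define the bidual cone. *)
Lemma bipolar_cone (R : realType) (E F : lmodType R)
    (p : {bilinear E -> F -> R | *%R & *%R}) (C : set E) :
  convex_cone C -> closed (C : set (sigma p)) ->
  dual_cone (flip_pairing p) (dual_cone p C) = C.
Proof.
move=> coneC clC; apply/seteqP; split=> [e Ce|x Cx y]; last exact.
apply: clC; apply/closure_sigma_convexP; first exact: convex_cone_convex.
move=> f s Cfs.
have s0 : 0 <= s by have := Cfs _ (convex_cone0 coneC); rewrite linear0l.
have /Ce : dual_cone p C (- f).
  move=> x Cx; rewrite linearNr oppr_ge0.
  apply: (@nonpos_of_scaled_bound _ _ s) => t t0; rewrite -linearZl_LR.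
  by apply: Cfs; exact: convex_coneZ.
by rewrite /flip_pairing linearNr; lra.
Qed.

(** * The set H and the dual value function *)

Lemma convex_setH (R : realType) (X Y Z : lmodType R)
    (pXY : {bilinear X -> Y -> R | *%R & *%R}) (A : {linear X -> Z})
    (b : Z) (c : Y) (P : set X) (Q : set Z) :
  convex_cone P -> convex_cone Q -> convex_subset (setH pXY A b c P Q).
Proof.
move=> coneP coneQ t [z1 r1] [z2 r2] t01.
move=> [x1 Px1 [/= [q1 Qq1 <-]]]; rewrite in_itv /= andbT => r1E.
move=> [x2 Px2 [/= [q2 Qq2 <-]]]; rewrite in_itv /= andbT => r2E.
exists ((1 - t) *: x1 + t *: x2); first exact: convex_cone_convex.
split=> /=; last first.
  rewrite in_itv /= andbT linearDl !linearZl_LR.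
  by have /andP[t0 t1] := t01; rewrite lerD // ler_wpM2l // subr_ge0.
exists ((1 - t) *: q1 + t *: q2); first exact: convex_cone_convex.
have bE : b = (1 - t) *: b + t *: b by rewrite -scalerDl subrK scale1r.
rewrite linearD !linearZ [in LHS]bE /= !scalerBr.
by rewrite [RHS]addrACA [X in _ = X + _]addrACA -!opprD.
Qed.

(** The adjoint is eliminated here, so that later arguments use [A] only. *)
Lemma dual_feasibleP (R : realType) (X Y Z W : lmodType R)
    (pXY : {bilinear X -> Y -> R | *%R & *%R})
    (pZW : {bilinear Z -> W -> R | *%R & *%R}) (A : X -> Z) (As : W -> Y)
    (c : Y) (P : set X) (Q : set Z) (w : W) :
  (forall x w, pXY x (As w) = pZW (A x) w) ->
  dual_feasible pXY pZW As c P Q w <->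
  (forall q, Q q -> 0 <= pZW q w) /\
  (forall x, P x -> pZW (A x) w <= pXY x c).
Proof.
move=> adj; have pairE x : pXY x (- As w + c) = pXY x c - pZW (A x) w.
  by rewrite linearDr linearNr adj addrC.
split=> -[Qw Pw]; split=> // x /Pw; first by rewrite pairE subr_ge0.
by rewrite /= pairE subr_ge0.
Qed.

(** What a half-space containing H imposes on its normal vector: the value
    at the base point x = 0, q = 0 gives the bound on - <b, w>, and the three sign
    conditions come from letting one parameter of H (the height above <x, c>, the
    point of [Q], the point of [P]) go to infinity along a ray while the other
    two vanish. *)
Lemma bounded_functional_setH (R : realType) (X Y Z W : lmodType R)
    (pXY : {bilinear X -> Y -> R | *%R & *%R})
    (pZW : {bilinear Z -> W -> R | *%R & *%R}) (A : {linear X -> Z})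
    (b : Z) (c : Y) (P : set X) (Q : set Z) (w : W) (beta s : R) :
  convex_cone P -> convex_cone Q ->
  (forall u, setH pXY A b c P Q u -> pairingR pZW u (w, beta) <= s) ->
  [/\ beta <= 0, - pZW b w <= s, forall q, Q q -> 0 <= pZW q w &
      forall x, P x -> pZW (A x) w <= - beta * pXY x c].
Proof.
move=> coneP coneQ bound.
have P0 := convex_cone0 coneP; have Q0 := convex_cone0 coneQ.
have {}bound x q k : P x -> Q q -> 0 <= k ->
    pZW (A x) w - pZW b w - pZW q w + (pXY x c + k) * beta <= s.
  move=> Px Qq k0; rewrite -!linearBl; apply: (bound (_, _)); exists x => //.
  by split; [exists q|rewrite /= in_itv /= andbT lerDl].
have b0 : - pZW b w <= s.
  have := bound 0 0 0 P0 Q0 (lexx 0).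
  by rewrite linear0 !linear0l; lra.
split=> // [|q Qq|x Px].
- apply: (@nonpos_of_scaled_bound _ _ (s + pZW b w)) => k k0.
  have := bound 0 0 k P0 Q0 k0.
  by rewrite linear0 !linear0l; lra.
- rewrite -oppr_le0; apply: (@nonpos_of_scaled_bound _ _ (s + pZW b w)) => k k0.
  have := bound 0 (k *: q) 0 P0 (convex_coneZ coneQ k0 Qq) (lexx 0).
  by rewrite linear0 !linear0l linearZl_LR; lra.
- rewrite -subr_le0; apply: (@nonpos_of_scaled_bound _ _ (s + pZW b w)) => k k0.
  have := bound (k *: x) 0 0 (convex_coneZ coneP k0 Px) Q0 (lexx 0).
  by rewrite linearZ !linear0l !linearZl_LR /=; lra.
Qed.

Lemma epigraph_value_dualP (R : realType) (X Y Z W : lmodType R)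
    (pXY : X -> Y -> R) (pZW : Z -> W -> R) (As : W -> Y)
    (b : Z) (c : Y) (P : set X) (Q : set Z) (z : Z) (r : R) :
  epigraph (value_dual pXY pZW As b c P Q) (z, r) <->
  forall w, dual_feasible pXY pZW As c P Q w -> pZW (b + z) w <= r.
Proof.
split=> [vr w Fw|vr].
  rewrite -lee_fin; apply: le_trans vr; apply: ereal_sup_ubound.
  by exists w.
by apply: ge_ereal_sup => _ [w Fw <-]; rewrite lee_fin; exact: vr.
Qed.

(** The epigraph is the intersection of half-spaces with normals (w, -1), for
    [w] dual feasible, and weak duality says that each of them contains H.
    Conversely, any half-space containing H is a consequence of these: rescale its
    normal when its boundary is not vertical, and otherwise use the normal as a
    recession direction of the dual feasible set. *)
Theorem closure_setH (R : realType) (X Y Z W : lmodType R)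
    (pXY : {bilinear X -> Y -> R | *%R & *%R})
    (pZW : {bilinear Z -> W -> R | *%R & *%R})
    (A : {linear X -> Z}) (As : W -> Y) (b : Z) (c : Y)
    (P : set X) (Q : set Z) :
  (forall x w, pXY x (As w) = pZW (A x) w) ->
  convex_cone P -> convex_cone Q ->
  dual_feasible pXY pZW As c P Q !=set0 ->
  closure (setH pXY A b c P Q : set (sigma (pairingR pZW))) =
  epigraph (value_dual pXY pZW As b c P Q).
Proof.
move=> adj coneP coneQ [w0 Fw0]; apply/seteqP; split=> -[z r].
  move=> Hzr; apply/epigraph_value_dualP => w.
  move=> /(dual_feasibleP _ _ _ _ adj)[Qw Pw].
  suff : pairingR pZW (z, r) (w, -1) <= - pZW b w.
    by rewrite /pairingR /= linearDl; lra.
  apply: closure_sigma_halfspace Hzr _ => -[_ k] [x Px [/= [q Qq <-]]].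
  rewrite in_itv /= andbT /pairingR /= !linearBl => xk.
  by have := Qw _ Qq; have := Pw _ Px; lra.
move=> /epigraph_value_dualP vr.
apply/(@closure_sigma_convexP _ _ _ (pairingR pZW)).
  exact: convex_setH.
suff polar (w : W) (beta s : R) :
    (forall u, setH pXY A b c P Q u -> pairingR pZW u (w, beta) <= s) ->
    pZW z w + (r : R) * beta <= s.
  by move=> [w beta] s; exact: polar.
move=> /bounded_functional_setH[]// beta0 bs Qw Pw.
suff : pZW (b + z) w + r * beta <= 0.
  by rewrite linearDl; lra.
(* For a vertical hyperplane, [w] can be added to the dual feasible point [w0]
   with any weight. *)
have [beta_eq0|beta_neq0] := eqVneq beta 0.
  rewrite beta_eq0 mulr0 addr0.
  apply: (@nonpos_of_scaled_bound _ _ (r - pZW (b + z) w0)) => t t0.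
  have /vr : dual_feasible pXY pZW As c P Q (w0 + t *: w).
    move: Fw0 => /(dual_feasibleP _ _ _ _ adj)[Qw0 Pw0].
    apply/(dual_feasibleP _ _ _ _ adj); split=> [q Qq|x Px].
      by rewrite linearDr linearZr_LR addr_ge0 ?Qw0 ?mulr_ge0 ?Qw.
    rewrite linearDr linearZr_LR -[leRHS]addr0 lerD ?Pw0 //.
    have := Pw _ Px; rewrite beta_eq0 oppr0 mul0r => Axw.
    by rewrite mulr_ge0_le0.
  by rewrite linearDr linearZr_LR; lra.
have nbeta_gt0 : 0 < - beta by rewrite oppr_gt0 lt_neqAle beta_neq0.
have /vr : dual_feasible pXY pZW As c P Q ((- beta)^-1 *: w).
  apply/(dual_feasibleP _ _ _ _ adj); split=> [q Qq|x Px].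
    by rewrite linearZr_LR mulr_ge0 ?Qw // invr_ge0 ltW.
  by rewrite linearZr_LR mulrC ler_pdivrMr // mulrC Pw.
by rewrite linearZr_LR mulrC ler_pdivrMr //; lra.
Qed.

(** * The set K by duality *)

Definition reflect_height {R : realType} {E : Type} (u : E * R) : E * R :=
  (u.1, - u.2).

Lemma reflect_heightK (R : realType) (E : Type) :
  involutive (@reflect_height R E).
Proof. by move=> [e r]; rewrite /reflect_height /= opprK. Qed.

(** Continuity gives one inclusion; the other is the same inclusion for the
    preimage of [C]. *)
Lemma closure_preimage_involution (T : topologicalType) (g : T -> T)
    (C : set T) :
  continuous g -> involutive g -> closure (g @^-1` C) = g @^-1` closure C.
Proof.
move=> cg gK.
have sub D : closure (g @^-1` D) `<=` g @^-1` closure D.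
  have clD : closed (g @^-1` closure D).
    apply: (@preimage_closed _ _ g (closure D)) => [v _|]; first exact: cg.
    exact: closed_closure.
  have sD : g @^-1` D `<=` g @^-1` closure D.
    by move=> x Dgx; exact: (@subset_closure _ D (g x) Dgx).
  by move=> x Dx; exact: (clD _ (closure_subset sD Dx)).
apply/seteqP; split=> [|x gx]; first exact: sub.
rewrite -(gK x); apply: (sub (g @^-1` C)).
by rewrite -comp_preimage (_ : g \o g = id) //; apply/funext => u /=;
   rewrite gK.
Qed.

(** The reflection is weakly continuous because composing it with the functional
    (f, beta) gives the functional (f, - beta). *)
Lemma closure_sigma_reflect (R : realType) (E F : lmodType R)
    (p : {bilinear E -> F -> R | *%R & *%R}) (C : set (E * R)) :
  closure (reflect_height @^-1` C : set (sigma (pairingR p))) =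
  reflect_height @^-1` closure (C : set (sigma (pairingR p))).
Proof.
apply: (@closure_preimage_involution (sigma (pairingR p))); last first.
  exact: reflect_heightK.
apply/continuous_sigmaP => -[f beta].
have -> :
    (fun u : sigma (pairingR p) => pairingR p (reflect_height u) (f, beta)) =
    (fun u : sigma (pairingR p) => pairingR p u (f, - beta)).
  by apply/funext => u; rewrite /pairingR /= mulrN mulNr.
by apply: (continuous_sigmaP (fun u : sigma (pairingR p) =>
  (u : sigma (pairingR p)))).1 => u; exact: cvg_id.
Qed.

(** The dual program with its objective negated is a primal program, whose map is
    the opposite of the adjoint; negating the objective reflects the heights. *)
Lemma setK_reflect_setH (R : realType) (X Y Z W : lmodType R)
    (pXY : X -> Y -> R) (pZW : {bilinear Z -> W -> R | *%R & *%R})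
    (As : W -> Y) (b : Z) (c : Y) (P : set X) (Q : set Z) :
  setK pXY pZW As b c P Q =
  reflect_height @^-1` setH (flip_pairing pZW) (\- As) (- c) (- b)
                         (dual_cone pZW Q) (dual_cone pXY P).
Proof.
apply/seteqP; split=> -[y r] [w Qw [[v Pv /= vy] /= rw]]; exists w => //;
  (split; first by exists v; rewrite //= -?vy /= ?opprK);
  by move: rw; rewrite /= !in_itv /= andbT /flip_pairing linearNl lerN2.
Qed.

Lemma hypograph_value_primalP (R : realType) (X Y Z : lmodType R)
    (pXY : X -> Y -> R) (A : X -> Z) (b : Z) (c : Y)
    (P : set X) (Q : set Z) (y : Y) (r : R) :
  hypograph (value_primal pXY A b c P Q) (y, r) <->
  forall x, primal_feasible A b P Q x -> r <= pXY x (c - y).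
Proof.
split=> [vr x Fx|vr].
  rewrite -lee_fin; apply: (le_trans vr); apply: ereal_inf_lbound.
  by exists x.
by apply: le_ereal_inf_tmp => _ [x Fx <-]; rewrite lee_fin; exact: vr.
Qed.

(** By the bipolar theorem the bidual program has the same constraints as the
    primal one. *)
Lemma dual_feasible_dual (R : realType) (X Y Z W : lmodType R)
    (pXY : {bilinear X -> Y -> R | *%R & *%R})
    (pZW : {bilinear Z -> W -> R | *%R & *%R}) (A : X -> Z) (b : Z)
    (P : set X) (Q : set Z) :
  convex_cone P -> convex_cone Q ->
  closed (P : set (sigma pXY)) -> closed (Q : set (sigma pZW)) ->
  dual_feasible (flip_pairing pZW) (flip_pairing pXY) (\- A) (- b)
    (dual_cone pZW Q) (dual_cone pXY P) = primal_feasible A b P Q.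
Proof.
move=> coneP coneQ clP clQ.
rewrite /dual_feasible (bipolar_cone coneP clP) (bipolar_cone coneQ clQ).
by apply/seteqP; split=> x /=; rewrite opprK.
Qed.

Theorem closure_setK (R : realType) (X Y Z W : lmodType R)
    (pXY : {bilinear X -> Y -> R | *%R & *%R})
    (pZW : {bilinear Z -> W -> R | *%R & *%R})
    (A : X -> Z) (As : {linear W -> Y}) (b : Z) (c : Y)
    (P : set X) (Q : set Z) :
  (forall x w, pXY x (As w) = pZW (A x) w) ->
  convex_cone P -> convex_cone Q ->
  closed (P : set (sigma pXY)) -> closed (Q : set (sigma pZW)) ->
  primal_feasible A b P Q !=set0 ->
  closure (setK pXY pZW As b c P Q :
             set (sigma (pairingR (flip_pairing pXY)))) =
  hypograph (value_primal pXY A b c P Q).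
Proof.
move=> adj coneP coneQ clP clQ feas.
rewrite setK_reflect_setH closure_sigma_reflect.
have FE := dual_feasible_dual A b coneP coneQ clP clQ.
rewrite (closure_setH (pXY := flip_pairing pZW) (A := \- As) (As := \- A)).
- apply/seteqP; split=> -[y r].
    move=> /epigraph_value_dualP vr; apply/hypograph_value_primalP => x Fx.
    have /vr : dual_feasible (flip_pairing pZW) (flip_pairing pXY) (\- A) (- b)
      (dual_cone pZW Q) (dual_cone pXY P) x by rewrite FE.
    by rewrite /= [- c + y]addrC -[y - c]opprB linearNl lerN2.
  move=> /hypograph_value_primalP vr; apply/epigraph_value_dualP => x.
  rewrite FE => /vr /=.
  by rewrite [- c + y]addrC -[y - c]opprB linearNl lerN2.
- by move=> w x /=; rewrite linearNr linearNl; congr (- _);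
    exact: esym (adj x w).
- exact: convex_cone_dual.
- exact: convex_cone_dual.
- by rewrite FE.
Qed.

Theorem theorem6p1 (R : realType) (X Y Z W : lmodType R)
  (pXY : {bilinear X -> Y -> R | *%R & *%R})
  (pZW : {bilinear Z -> W -> R | *%R & *%R})
  (sepXY : separated_pair pXY) (sepZW : separated_pair pZW)
  (A : {linear X -> Z}) (As : {linear W -> Y})
  (contA : continuous (A : sigma pXY -> sigma pZW))
  (adjA : forall (x : X) (w : W), pXY x (As w) = pZW (A x) w)
  (P : set X) (Q : set Z) (coneP : convex_cone P) (coneQ : convex_cone Q)
  (b : Z) (c : Y)
  (feasP : primal_feasible A b P Q !=set0)
  (feasD : dual_feasible pXY pZW As c P Q !=set0) :
  closure (setH pXY A b c P Q : set (sigma (pairingR pZW)))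
    = epigraph (value_dual pXY pZW As b c P Q)
  /\
  (closed (P : set (sigma pXY)) -> closed (Q : set (sigma pZW)) ->
   closure (setK pXY pZW As b c P Q :
              set (sigma (pairingR (fun (y : Y) (x : X) => pXY x y))))
     = hypograph (value_primal pXY A b c P Q)).
Proof.
split=> [|clP clQ]; first exact: closure_setH.
exact: closure_setK.
Qed.
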